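(* Let $F$ be a polybox in a $d$-box $X$ and let $\varepsilon\in\mathbb{Z}_2^d$, $\varepsilon\neq0$. If $F^{(\varepsilon)}=F$, then $\operatorname{ind}(F,B)\equiv0\pmod 2$ for every box $B\neq X$ of $X$. If moreover the number $|i(B)\cap\operatorname{supp}\varepsilon|$ is odd, then $\operatorname{ind}(F,B)=0$.
   Context: A $d$-box is $X=X_1\times\cdots\times X_d$ with finite nonempty sets $X_i$. A box is a nonempty $A_1\times\cdots\times A_d$ with $A_i\subseteq X_i$, proper if $A_i\neq X_i$ for all $i$. Boxes $A,B$ are dichotomous if $A_i=X_i\setminus B_i$ for some $i$; a suit is a family of pairwise dichotomous boxes, proper if all boxes are proper; a polybox is a nonempty union of a suit. For a box $A$ and $\varepsilon\in\mathbb{Z}_2^d$, $A^\varepsilon=A_1^{\varepsilon_1}\times\cdots\times A_d^{\varepsilon_d}$ with $A_i^0=A_i$, $A_i^1=X_i\setminus A_i$. For a polybox $F$, $F^{(\varepsilon)}=\bigcup_{A\in\mathcal{F}}A^\varepsilon$ for any proper suit $\mathcal{F}$ for $F$ (independent of the choice). $\operatorname{supp}\varepsilon=\{i:\varepsilon_i=1\}$, $i(B)=\{i:B_i\neq X_i\}$. For a box $C$, $\varphi_C(A)=\prod_i\varphi_{C_i}(A_i)$ on proper boxes $A$, with $\varphi_{C_i}(A_i)=[A_i=C_i]-[A_i=X_i\setminus C_i]$ if $C_i\neq X_i$ and $\varphi_{C_i}\equiv1$ if $C_i=X_i$; the index is $\operatorname{ind}(F,C)=\sum_{A\in\mathcal{F}}\varphi_C(A)$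 for any proper suit $\mathcal{F}$ for $F$ (independent of the choice). *)

(* Defs.v *)
From HB Require Import structures.
From mathcomp Require Import all_boot all_order all_algebra.
From mathcomp Require Import zify.

Set Implicit Arguments.
Unset Strict Implicit.
Unset Printing Implicit Defensive.

Import Order.TTheory GRing.Theory Num.Theory.
Local Open Scope ring_scope.

Section Polyboxes.

Variables (d : nat) (X : 'I_d -> finType).

Definition dbox : finType := {dffun forall i : 'I_d, X i}.

(* A box A_1 x ... x A_d is given by its family of factors; the subset of the
   d-box that it denotes is [setXn A].  Since the factors of a box are required
   to be nonempty, they are determined by that subset. *)
Definition factors : finType := {dffun forall i : 'I_d, {set X i}}.

Implicit Types (A B C : factors) (S : {set factors}) (F : {set dbox})
  (eps : {ffun 'I_d -> 'Z_2}).

Definition is_box A : bool := [forall i, A i != set0].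

Definition proper_box A : bool := is_box A && [forall i, A i != setT].

Definition dichotomous A B : bool := [exists i, A i == ~: B i].

Definition suit S : bool :=
  [forall A in S, is_box A] &&
  [forall A in S, forall B in S, (A != B) ==> dichotomous A B].

Definition proper_suit S : bool := suit S && [forall A in S, proper_box A].

Definition suit_union S : {set dbox} := \bigcup_(A in S) setXn A.

Definition polybox F : Prop :=
  F != set0 /\ exists S, suit S /\ suit_union S = F.

Definition proper_suit_for F S : bool := proper_suit S && (suit_union S == F).

(* Some proper suit for F.  Every polybox has one as soon as each X i has at
   least two points ([exists_proper_suit]); if some X i is a singleton there is
   no proper box, and the value is then the empty family. *)
Definition a_proper_suit F : {set factors} :=
  odflt set0 [pick S | proper_suit_for F S].

Definition box_flip A eps : factors :=
  [ffun i : 'I_d => (if eps i == 0 then A i else ~: A i) : {set X i}].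

Definition flip_union S eps : {set dbox} :=
  \bigcup_(A in S) setXn (box_flip A eps).

(* F^(eps); see [polybox_flipE] for the independence of the suit. *)
Definition polybox_flip F eps : {set dbox} := flip_union (a_proper_suit F) eps.

Definition supp eps : {set 'I_d} := [set i | eps i == 1].

(* The set i(B). *)
Definition proper_coords B : {set 'I_d} := [set i | B i != setT].

Definition phi1 (T : finType) (C A : {set T}) : int :=
  if C == setT then 1 else (A == C)%:R - (A == ~: C)%:R.

Definition phi C A : int := \prod_i phi1 (C i) (A i).

Definition suit_index S C : int := \sum_(A in S) phi C A.

(* ind(F, C); see [indE] for the independence of the suit. *)
Definition ind F C : int := suit_index (a_proper_suit F) C.

End Polyboxes.

Lemma sum_prod_dffun (d : nat) (Y : 'I_d -> finType) (P : forall i, Y i -> int) :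
  \sum_(t : {dffun forall i : 'I_d, Y i}) \prod_i P i (t i)
    = \prod_i \sum_(y : Y i) P i y.
Proof.
under [RHS]eq_bigr => i _ do rewrite (big_tag (fun i y => P i y)).
rewrite bigA_distr_big_dep.
transitivity (\sum_(t : fprod Y) \prod_(i in 'I_d) finfun (P i) (t i)).
  rewrite (reindex (@dffun_of_fprod _ Y)); last first.
    exact/onW_bij/dffun_of_fprod_bij.
  by apply: eq_bigr => t _; apply: eq_bigr => i _; rewrite !ffunE.
rewrite big_fprod; apply: eq_bigr => g /familyP gY; apply: eq_bigr => i _.
move: (gY i); rewrite inE; case: (g i) => /= j y /eqP e.
by case: i / e gY; rewrite !untagE /etagged /= ffunE.
Qed.

(* Independence of the index from the suit: on subsets E of T of odd size, the
   signs (-1)^#|A :&: E| attached to distinct classes {A, ~: A} of proper sets A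
   are orthogonal, while for a product E of sets of odd size at most one member
   of a suit meets E in an odd number of points.  Hence, up to a nonzero factor,
   the index is a signed sum over such E of the parity of #|F :&: E|. *)
Section OneCoordinate.

Variable T : finType.
Implicit Types A C D E : {set T}.

Lemma odd_card_symdiff D E :
  odd #|(D :\: E) :|: (E :\: D)| = odd #|D| (+) odd #|E|.
Proof.
rewrite cardsU (_ : _ :&: _ = set0) ?cards0 ?subn0; last first.
  by apply/setP => x; rewrite !inE; do 2!case: (_ \in _).
rewrite -(cardsID E D) -(cardsID D E) (setIC E D) !oddD.
by do 3!case: (odd _).
Qed.

Lemma sum_sign_odd D : D != set0 -> D != setT ->
  \sum_(E : {set T} | odd #|E|) (-1) ^+ odd #|D :&: E| = 0 :> int.
Proof.
move=> /set0Pn[a aD]; rewrite -subTset => /subsetPn[b _ bD].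
pose P := [set a; b]; pose h E : {set T} := (P :\: E) :|: (E :\: P).
have hK : involutive h.
  move=> E; apply/setP => x; rewrite /h !inE.
  by do 2!case: (_ == _); case: (_ \in _).
have ab : a != b by apply: contraNneq bD => <-.
have oP : odd #|P| = false by rewrite cards2 ab.
have oDP : odd #|D :&: P|.
  rewrite (_ : D :&: P = [set a]) ?cards1 //; apply/setP => x; rewrite !inE.
  by have [->|_] := eqVneq x a; rewrite ?aD //; case: eqVneq => [->|];
    rewrite ?(negPf bD) ?andbF.
set s := LHS; suff: s = - s by lia.
rewrite {1}/s (reindex_inj (inv_inj hK)) /= -sumrN; apply: eq_big => E.
  by rewrite odd_card_symdiff oP.
move=> _; rewrite (_ : D :&: h E = ((D :&: P) :\: (D :&: E)) :|:
                                   ((D :&: E) :\: (D :&: P))).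
  by rewrite odd_card_symdiff oDP signr_addb mulN1r.
by apply/setP => x; rewrite !inE; case: (x \in D).
Qed.

Definition weight C E : int := if C == setT then 1 else (-1) ^+ odd #|C :&: E|.

Lemma sum_weight C : C != set0 -> exists2 k : int,
  k != 0 & forall A, A != set0 -> A != setT ->
  2 * \sum_(E : {set T} | odd #|E|) weight C E * (odd #|A :&: E|)%:R
    = k * phi1 C A.
Proof.
move=> C0; pose N : int := \sum_(E : {set T} | odd #|E|) 1.
have N0 : N != 0.
  have [x _] := set0Pn _ C0.
  rewrite /N (bigD1 [set x]) ?cards1 //=.
  by apply: lt0r_neq0; rewrite ltr_wpDr ?sumr_ge0.
exists (if C == setT then N else - N); first by case: ifP; rewrite ?oppr_eq0.
move=> A A0 AT.
have two (b : bool) : 2 * b%:R = 1 - (-1) ^+ b :> int by case: b.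
have sA := sum_sign_odd A0 AT.
rewrite /weight /phi1 mulr_sumr.
have [CT|CT] := eqVneq C setT.
  under eq_bigr do rewrite mul1r two.
  by rewrite sumrB sA subr0 mulr1.
pose D := (C :\: A) :|: (A :\: C).
have E1 E : 2 * ((-1) ^+ odd #|C :&: E| * (odd #|A :&: E|)%:R)
    = (-1) ^+ odd #|C :&: E| - (-1) ^+ odd #|D :&: E| :> int.
  rewrite mulrCA two mulrBr mulr1 -signr_addb -odd_card_symdiff.
  congr (_ - (-1) ^+ odd #|pred_of_set _|); apply/setP => x; rewrite !inE.
  by case: (x \in E); rewrite ?andbF ?andbT.
under eq_bigr do rewrite E1.
rewrite sumrB (sum_sign_odd C0 CT) sub0r.
have [AC|AC] := eqVneq A C.
  have -> : (A == ~: C) = false.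
    rewrite AC; apply/negbTE; apply/eqP => e; move: C0; rewrite -subset0.
    by rewrite -(setICr C) -e setIid subxx.
  rewrite subr0 mulr1 /D AC setDv setU0; congr (- _); apply: eq_bigr => E _.
  by rewrite set0I cards0.
have [AC'|AC'] := eqVneq A (~: C).
  rewrite sub0r mulrNN mulr1 -sumrN; apply: eq_bigr => E oE.
  rewrite (_ : D = setT) ?setTI ?oE ?opprK //.
  by apply/setP => x; rewrite /D AC' !inE; case: (x \in C).
rewrite subr0 mulr0 sum_sign_odd ?oppr0 //.
- apply: contraNneq AC => /setP D0; apply/eqP/setP => x.
  by have := D0 x; rewrite /D !inE; do 2!case: (x \in _).
- apply: contraNneq AC' => /setP D0; apply/eqP/setP => x.
  by have := D0 x; rewrite /D !inE; do 2!case: (x \in _).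
Qed.

Lemma sum_phi1 (x : T) A (s : bool) : A != set0 -> A != setT ->
  \sum_(C : {set T} | x \in C) (if C == setT then 1 else (-1) ^+ s) * phi1 C A
    = 2 * ((x \in A) (+) s)%:R.
Proof.
move=> A0 AT; rewrite (bigD1 setT) ?inE //= /phi1 eqxx mul1r.
have AC : A != ~: A.
  apply: contra_neq A0 => e.
  by apply/eqP; rewrite -subset0 -(setICr A) -e setIid subxx.
pose A' := if x \in A then A else ~: A.
have xA' : x \in A' by rewrite /A'; case: ifP => //; rewrite inE => ->.
have A'T : A' != setT.
  rewrite /A'; case: ifP => // _; apply: contra_neq A0 => /(congr1 (@setC _)).
  by rewrite setCK setCT.
rewrite (bigD1 A') /= ?xA' // big1 ?addr0 => [|C].
  rewrite (negPf A'T) /A'; case: (x \in A).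
    by rewrite eqxx (negPf AC) subr0; case: s.
  by rewrite setCK eqxx (negPf AC) sub0r; case: s.
move=> /andP[/andP[xC CT] CA']; rewrite (negPf CT).
have -> : (A == C) = false.
  by apply: contraNF CA' => /eqP e; rewrite /A' e xC eqxx.
have -> : (A == ~: C) = false; last by rewrite subrr mulr0.
apply: contraNF CA' => /eqP e.
by rewrite /A' e inE xC setCK eqxx.
Qed.

End OneCoordinate.

Section Independence.

Variables (d : nat) (X : 'I_d -> finType).

Implicit Types (A B C : factors X) (S : {set factors X}) (F : {set dbox X})
  (eps : {ffun 'I_d -> 'Z_2}).


Lemma suit_disjoint S A B x : suit S -> A \in S -> B \in S ->
  x \in setXn A -> x \in setXn B -> A = B.
Proof.
move=> /andP[_ /forall_inP sS] AS BS /setXnP xA /setXnP xB.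
apply/eqP; apply/negPn/negP => nAB.
have /existsP[i /eqP e] := implyP (forall_inP (sS A AS) B BS) nAB.
by have := xA i; rewrite e inE xB.
Qed.

Lemma even_sum (I : finType) (P : pred I) (f : I -> nat) :
  (forall i, P i -> odd (f i) = false) -> odd (\sum_(i | P i) f i) = false.
Proof.
move=> ev; apply: (big_ind (fun n : nat => odd n = false)) => // m n.
by rewrite oddD => -> ->.
Qed.

Lemma odd_suit S (E : factors X) : suit S -> (forall i, odd #|E i|) ->
  \sum_(A in S) \prod_i (odd #|A i :&: E i|)%:R
    = (odd #|suit_union S :&: setXn E|)%:R :> int.
Proof.
move=> sS oE.
have oA A : \prod_i (odd #|A i :&: E i|)%:R
    = (odd #|setXn A :&: setXn E|)%:R :> int.
  have -> : setXn A :&: setXn E = setXn (fun i => A i :&: E i).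
    apply/setP => x; rewrite !inE; apply/andP/forallP => /=.
      by case=> /forallP xA /forallP xE i; rewrite inE xA xE.
    by move=> h; split; apply/forallP => i; have := h i; rewrite inE; case/andP.
  rewrite cardsXn.
  apply: (big_ind2 (fun (x : int) (y : nat) => x = (odd y)%:R)) => //.
  by move=> x1 x2 y1 y2 -> ->; rewrite oddM; do 2!case: (odd _).
have cU : #|suit_union S :&: setXn E| = (\sum_(A in S) #|setXn A :&: setXn E|)%N.
  rewrite -sum1_card.
  under [RHS]eq_bigr do rewrite -sum1_card big_mkcond.
  rewrite exchange_big big_mkcond; apply: eq_bigr => x _.
  have [/setIP[/bigcupP[A AS xA] xE]|nx] := ifPn.
    rewrite (bigD1 A) //= inE xA xE big1 // => B /andP[BS BA].
    rewrite inE xE andbT ifF //; apply: contraNF BA => xB.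
    by rewrite (suit_disjoint sS BS AS xB xA).
  rewrite big1 // => A AS; rewrite ifF //; apply: contraNF nx.
  by case/setIP=> xA xE; rewrite inE xE andbT; apply/bigcupP; exists A.
under eq_bigr do rewrite oA.
rewrite cU; have [A /andP[AS oddA]|ev] :=
  pickP (fun A => (A \in S) && odd #|setXn A :&: setXn E|); last first.
  rewrite big1 => [|A AS]; last by have := ev A; rewrite AS /= => ->.
  by rewrite even_sum // => A AS; have := ev A; rewrite AS.
have ev B : (B \in S) && (B != A) -> odd #|setXn B :&: setXn E| = false.
  case/andP=> BS BA.
  have /andP[_ /forall_inP dS] := sS.
  have /existsP[i /eqP e] := implyP (forall_inP (dS B BS) A AS) BA.
  apply/negP => oddB.
  have all_odd C : odd #|setXn C :&: setXn E| -> forall i, odd #|C i :&: E i|.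
    move=> oC j; have := oA C; rewrite oC (bigD1 j) //=.
    by case: (odd _) => //; rewrite mul0r.
  have := oE i; rewrite -(cardsID (A i) (E i)) oddD setIC all_odd //.
  by rewrite setDE -e setIC all_odd.
rewrite (bigD1 A) //= oddA.
have -> : odd (\sum_(B in S) #|setXn B :&: setXn E|) = true.
  by rewrite (bigD1 A) //= oddD oddA even_sum.
by rewrite big1 ?addr0 // => B hB; rewrite ev.
Qed.

Lemma proper_suitP S A : proper_suit S -> A \in S ->
  forall i, (A i != set0) * (A i != setT).
Proof.
case/andP=> _ /forall_inP pS /pS /andP[/forallP h0 /forallP hT] i.
by split; [exact: h0 | exact: hT].
Qed.

Lemma suit_index_eq S S' C : is_box C -> proper_suit S -> proper_suit S' ->
  suit_union S = suit_union S' -> suit_index S C = suit_index S' C.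
Proof.
move=> /forallP bC pS pS' eU.
have sw i := sum_weight (bC i).
have [k [k0 kE]] : exists k : 'I_d -> int, (forall i, k i != 0) /\
    forall i (A : {set X i}), A != set0 -> A != setT ->
    2 * \sum_(E : {set X i} | odd #|E|) weight (C i) E * (odd #|A :&: E|)%:R
      = k i * phi1 (C i) A.
  have [k kP] := fin_all_exists (fun i => let: ex_intro2 k k0 kE := sw i in
      ex_intro (fun k : int => k != 0 /\ forall A : {set X i},
        A != set0 -> A != setT ->
        2 * \sum_(E : {set X i} | odd #|E|) weight (C i) E * (odd #|A :&: E|)%:R
          = k * phi1 (C i) A) k (conj k0 kE)).
  by exists k; split=> i; case: (kP i).
have main S0 : proper_suit S0 -> (\prod_i k i) * suit_index S0 C
    = \prod_(i < d) 2 * \sum_(E : factors X | [forall i, odd #|E i|])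
        (\prod_i weight (C i) (E i)) *
        (odd #|suit_union S0 :&: setXn E|)%:R.
  move=> pS0; have /andP[sS0 _] := pS0.
  under [X in _ = _ * X]eq_bigr => E /forallP oE do
    rewrite -(odd_suit sS0 oE) mulr_sumr.
  rewrite exchange_big /= /suit_index !mulr_sumr; apply: eq_bigr => A AS.
  rewrite -big_split /=; under eq_bigr => i _ do
    rewrite -kE ?(proper_suitP pS0 AS) // big_mkcond.
  rewrite big_split /= -sum_prod_dffun; congr (_ * _).
  rewrite [RHS]big_mkcond; apply: eq_bigr => E _.
  case: ifPn => [/forallP oE|/forallPn[i /negPf oE]].
    by rewrite -big_split; apply: eq_bigr => i _; rewrite oE.
  by rewrite (bigD1 i) //= oE mul0r.
have kn0 : \prod_i k i != 0 by apply/prodf_neq0 => i _.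
by apply: (mulfI kn0); rewrite !main // eU.
Qed.

Lemma flip_union_eq S S' eps : proper_suit S -> proper_suit S' ->
  suit_union S = suit_union S' -> flip_union S eps = flip_union S' eps.
Proof.
move=> pS pS' eU.
have main S0 x : proper_suit S0 -> (x \in flip_union S0 eps) =
    (\sum_(C : factors X | [forall i, x i \in C i])
      (\prod_i (if C i == setT then 1 else (-1) ^+ (eps i != 0)))
        * suit_index S0 C != 0).
  move=> pS0; under eq_bigr do rewrite mulr_sumr.
  rewrite exchange_big /=.
  have e A : A \in S0 -> \sum_(C : factors X | [forall i, x i \in C i])
      (\prod_i (if C i == setT then 1 else (-1) ^+ (eps i != 0))) * phi C A
      = \prod_(i < d) 2 * (x \in setXn (box_flip A eps))%:R.
    move=> AS; pose P i (D : {set X i}) : int := if x i \in D then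
      (if D == setT then 1 else (-1) ^+ (eps i != 0)) * phi1 D (A i) else 0.
    transitivity (\sum_(C : factors X) \prod_i P i (C i)).
      rewrite big_mkcond; apply: eq_bigr => C _.
      case: ifPn => [/forallP xC|/forallPn[i /negPf xC]].
        by rewrite -big_split; apply: eq_bigr => i _; rewrite /P xC.
      by rewrite (bigD1 i) //= /P xC mul0r.
    rewrite sum_prod_dffun; under eq_bigr => i _ do
      rewrite /P -big_mkcond sum_phi1 ?(proper_suitP pS0 AS) //.
    rewrite big_split; congr (_ * _); rewrite inE.
    have fE i : (x i \in box_flip A eps i) = (x i \in A i) (+) (eps i != 0).
      by rewrite ffunE; case: (eps i == 0); rewrite ?inE ?addbF ?addbT.
    case: (boolP (x \in _)) => [/familyP xA|nx].
      by rewrite big1 // => i _; have := xA i; rewrite /= fE => ->.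
    have /forallPn[i xi] : ~~ [forall i, x i \in box_flip A eps i] by [].
    by move: xi; rewrite fE (bigD1 i) //= => /negPf->; rewrite mul0r.
  rewrite (eq_bigr _ e) -mulr_sumr mulf_eq0 negb_or.
  have -> : \prod_(i < d) (2 : int) != 0 by apply/prodf_neq0.
  rewrite -natr_sum pnatr_eq0 sum_nat_eq0 negb_forall_in.
  apply/bigcupP/exists_inP => -[A AS xA]; exists A => //.
    by rewrite xA.
  by move: xA; case: (_ \in _).
apply/setP => x; rewrite !main //; congr (_ != 0).
apply: eq_bigr => C /forallP xC; rewrite (suit_index_eq (S' := S')) //.
by apply/forallP => i; apply/set0Pn; exists (x i).
Qed.

Lemma a_proper_suitP F S : proper_suit_for F S ->
  proper_suit_for F (a_proper_suit F).
Proof. by rewrite /a_proper_suit; case: pickP => //= h; rewrite h. Qed.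

Lemma polybox_flipE F S eps : proper_suit_for F S ->
  polybox_flip F eps = flip_union S eps.
Proof.
move=> hS; have /andP[pS' /eqP uS'] := a_proper_suitP hS.
by have /andP[pS /eqP uS] := hS; apply: flip_union_eq; rewrite ?uS.
Qed.

Lemma indE F S C : is_box C -> proper_suit_for F S ->
  ind F C = suit_index S C.
Proof.
move=> bC hS; have /andP[pS' /eqP uS'] := a_proper_suitP hS.
by have /andP[pS /eqP uS] := hS; apply: suit_index_eq; rewrite ?uS.
Qed.

Lemma exists_proper_suit F : (forall i, (1 < #|X i|)%N) -> polybox F ->
  exists S, proper_suit_for F S.
Proof.
move=> X2 [_ [S [/andP[/forall_inP bS /forall_inP dS] <-]]].
have [a _] : exists a : forall i, X i, True.
  have [a _] := fin_all_exists (fun i => card_gt0P (ltnW (X2 i))).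
  by exists a.
pose D i : {set X i} := [set a i].
have D0 i : D i != set0 by apply/set0Pn; exists (a i); rewrite inE.
have DT i : D i != setT.
  by apply: contraTneq (X2 i) => e; rewrite -cardsT -e cards1.
have C0 i : ~: D i != set0.
  by apply: contra_neq (DT i) => e; rewrite -[D i]setCK e setC0.
have CT i : ~: D i != setT.
  by apply: contra_neq (D0 i) => e; rewrite -[D i]setCK e setCT.
pose ref A B := [forall i, if A i == setT then (B i == D i) || (B i == ~: D i)
                           else B i == A i].
have refP A B i : ref A B -> A i != setT -> B i = A i.
  by move=> /forallP/(_ i); case: ifP => // _ /eqP.
have properP A B : A \in S -> ref A B -> proper_box B.
  move=> /bS/forallP A0 /forallP AB; apply/andP; split; apply/forallP => i;
    have := AB i; case: ifPn => [_ /orP[]|AT] /eqP->;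
    by [exact: D0 | exact: DT | exact: C0 | exact: CT | exact: A0 | exact: AT].
pose S' := [set B | [exists A in S, ref A B]]; exists S'.
apply/andP; split; [apply/andP; split; [apply/andP; split|]|].
- apply/forall_inP => B; rewrite inE => /exists_inP[A AS AB].
  by have /andP[] := properP _ _ AS AB.
- apply/forall_inP => B; rewrite inE => /exists_inP[A AS AB].
  apply/forall_inP => B'; rewrite inE => /exists_inP[A' AS' AB'].
  apply/implyP => BB'; have [e|AA'] := eqVneq A A'.
    have /existsP[i nB] : [exists i, B i != B' i].
      rewrite -negb_forall; apply: contra BB' => /forallP h.
      by apply/eqP/ffunP => i; apply/eqP.
    apply/existsP; exists i; subst A'.
    have := forallP AB i; have := forallP AB' i.
    case: ifP => _; last by move=> /eqP e1 /eqP e2; rewrite e1 e2 eqxx in nB.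
    by case/orP=> /eqP e1 /orP[] /eqP e2; move: nB; rewrite e1 e2 ?eqxx ?setCK.
  have /existsP[i /eqP e] := implyP (forall_inP (dS A AS) A' AS') AA'.
  apply/existsP; exists i; rewrite (refP _ _ _ AB) ?(refP _ _ _ AB') ?e //.
    apply: contra_neq (forallP (bS A AS) i) => e'; by rewrite e e' setCT.
  apply: contra_neq (forallP (bS A' AS') i) => e'.
  by rewrite -[A' i]setCK e' setCT.
- apply/forall_inP => B; rewrite inE => /exists_inP[A AS AB].
  exact: properP AS AB.
apply/eqP/setP => x; apply/bigcupP/bigcupP => -[].
  move=> B; rewrite inE => /exists_inP[A AS AB] /setXnP xB; exists A => //.
  apply/setXnP => i; have [->|AT] := eqVneq (A i) setT; first by rewrite inE.
  by rewrite -(refP _ _ _ AB AT).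
move=> A AS /setXnP xA.
pose B : factors X := [ffun i => (if A i == setT then
  (if x i \in D i then D i else ~: D i) else A i) : {set X i}].
exists B; last by apply/setXnP => i; rewrite ffunE; case: ifP => // _;
  case: ifPn => //; rewrite !inE.
rewrite inE; apply/exists_inP; exists A => //; apply/forallP => i.
by rewrite ffunE; case: (A i == setT) => //; case: ifP => _; rewrite eqxx ?orbT.
Qed.

End Independence.

(* Main.v *)
(** Since S^eps is again a proper suit for F, the index is multiplied by
    (-1)^|i(B) :&: supp eps| when S is replaced by S^eps; this gives the second
    claim. More generally, sums over S of products of functionals u_i with
    u_i(A) + u_i(~A) constant are combinations of indices, hence invariant under
    eps; this applies to literals, the 0/1-valued u_i with u_i(A) + u_i(~A) = 1.

    If B_i = X_i for some i in supp eps, a literal at i selects exactly half of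
    the index up to sign, so the index is even. Otherwise supp eps is contained
    in i(B). Each factor of phi_B outside supp eps is a signed sum of two
    literals, so it suffices to fix literals z there and to count modulo 2 the
    members of S over z whose type (up to complements) on supp eps is that of B.
    By the first case every line of types in a direction of supp eps has even
    count; hence one odd type produces at least 2^|supp eps| members of S over
    z. Being pairwise dichotomous on supp eps, they then cover everything over
    z, and the count is that of the full box, which is even. *)

Require Import Defs.
From mathcomp Require Import all_boot all_order all_algebra.
From mathcomp Require Import zify ring.

Import GRing.Theory.
Local Open Scope ring_scope.

Set Implicit Arguments.
Unset Strict Implicit.

(** * Parity in ['F_2] and complements of sets *)

Lemma intr_F2_eq0 (x : int) : x%:~R = 0 :> 'F_2 -> (x = 0 %[mod 2])%Z.
Proof.
rewrite {1}(divz_eq x 2) intrD intrM.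
have -> : (2 : int)%:~R = 0 :> 'F_2 by apply/val_inj.
rewrite mulr0 add0r.
have : (0 <= x %% 2 < 2)%Z by lia.
case: (x %% 2)%Z => [[|[|n]]|n] //; lia.
Qed.

Lemma addrr_F2 (x : 'F_2) : x + x = 0.
Proof. by rewrite addrr_pchar2 // pchar_Fp. Qed.

Lemma prod_natb (R : comNzRingType) (I : finType) (b : pred I) :
  \prod_i (b i)%:R = [forall i, b i]%:R :> R.
Proof.
case: forallP => [b1|/forallP/forallPn[i /negPf bi]].
  by rewrite big1 // => i _; rewrite b1.
by rewrite (bigD1 i) //= bi mul0r.
Qed.

Lemma setC_neq (T : finType) (A : {set T}) : A != set0 -> A != ~: A.
Proof.
apply: contra_neq => e.
by apply/eqP; rewrite -subset0 -(setICr A) -e setIid subxx.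
Qed.

Lemma setC_eqT (T : finType) (A : {set T}) : (~: A == setT) = (A == set0).
Proof. by rewrite -setC0 (inj_eq (@setC_inj _)). Qed.

Lemma setC_eq (T : finType) (A C : {set T}) : (~: A == C) = (A == ~: C).
Proof. by rewrite -{1}(setCK C) (inj_eq (@setC_inj _)). Qed.

(** * Functionals on the subsets of one factor *)

Section Literals.

Variable T : finType.
Implicit Types (A C : {set T}) (u : {set T} -> int) (v : {set T} -> bool).

Definition literal v := forall A, v (~: A) = ~~ v A.

Definition mem_literal (x : T) : {set T} -> bool := fun A => x \in A.

Lemma mem_literalP x : literal (mem_literal x).
Proof. by move=> A; rewrite /mem_literal inE. Qed.

Definition same_class C A := (A == C) || (A == ~: C).

Lemma same_classC C A : same_class C (~: A) = same_class C A.
Proof. by rewrite /same_class !setC_eq setCK orbC. Qed.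

(** Negating a literal on one whole class [{C, ~: C}] gives a second literal; the difference of the
    two is supported on that class. *)
Definition toggle C v A := v A (+) same_class C A.

Lemma toggleP C v : literal v -> literal (toggle C v).
Proof.
by move=> lv A; rewrite /toggle same_classC lv; case: (v A); case: same_class.
Qed.

(** The generic branch of [phi1], without the exceptional value at [C = setT]. *)
Definition class_sign C A : int := (A == C)%:R - (A == ~: C)%:R.

Lemma class_signC C A : class_sign C (~: A) = - class_sign C A.
Proof. by rewrite /class_sign !setC_eq setCK opprB. Qed.

(** Off the class of [C] the two literals cancel; on it they tell [C] from its complement, since
    only [C] contains [x]. *)
Lemma class_signE C A x : x \in C ->
  class_sign C A = (mem_literal x A)%:R - (toggle C (mem_literal x) A)%:R.
Proof.
move=> xC; have CC : C != ~: C by apply: setC_neq; apply/set0Pn; exists x.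
rewrite /class_sign /toggle /same_class /mem_literal.
have [->|_] := eqVneq A C; first by rewrite xC (negPf CC).
by have [->|_] := eqVneq A (~: C); rewrite ?inE ?xC //= addbF !subrr.
Qed.

(** Modulo 2 the sign is lost. If [T] were empty, [C] would be its own complement and the two terms
    would cancel. *)
Lemma class_sign_F2 C A : (0 < #|T|)%N ->
  (class_sign C A)%:~R = (same_class C A)%:R :> 'F_2.
Proof.
case/card_gt0P=> x _; rewrite /class_sign /same_class.
have CC : C != ~: C.
  by apply/eqP => /setP/(_ x); rewrite inE; case: (x \in C).
have [->|_] := eqVneq A C; first by rewrite (negPf CC).
by case: (A == ~: C) => //; apply/val_inj.
Qed.

(** Coefficients of [4 * u] in terms of the [phi1 C]; the factor 4 avoids fractions. The value 0 at
    [set0] discards products that are not boxes. *)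
Definition phi_coef u (k : int) C : int :=
  if C == set0 then 0 else if C == setT then 2 * k else u C - u (~: C).

(** Only [setT], [A] and [~: A] contribute: the first gives [2 * k], each of the other two gives
    [u A - u (~: A)]. *)
Lemma sum_phi_coef u k A : (forall A, u A + u (~: A) = k) ->
  A != set0 -> A != setT ->
  \sum_(C : {set T}) phi_coef u k C * phi1 C A = 4 * u A.
Proof.
move=> uk A0 AT; have AC := setC_neq A0.
have C0 : ~: A != set0 by rewrite -setCT (inj_eq (@setC_inj _)).
have CT : ~: A != setT by rewrite setC_eqT.
have T0 : setT != set0 :> {set T}.
  by apply: contra_neq A0 => e; apply/eqP; rewrite -subset0 -e subsetT.
rewrite (bigD1 setT) //= (bigD1 A) //= (bigD1 (~: A)) /=; last first.
  by rewrite CT eq_sym AC.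
rewrite big1 => [|C /andP[/andP[C1 C2] C3]]; last first.
  rewrite /phi1 (negPf C1) (eq_sym A) (negPf C2) -setC_eq (eq_sym (~: A)).
  by rewrite (negPf C3) subrr mulr0.
rewrite /phi_coef /phi1 eqxx (negPf T0) (negPf A0) (negPf AT) (negPf C0).
rewrite (negPf CT) setCK !eqxx (negPf AC) /=; have := uk A; lia.
Qed.

End Literals.

(** * Sums over suits and their invariance under the flip *)

Section Suits.

Variables (d : nat) (X : 'I_d -> finType).
Implicit Types (A B : factors X) (S : {set factors X}).
Implicit Type eps : {ffun 'I_d -> 'Z_2}.
Implicit Types (u : forall i, {set X i} -> int) (v : forall i, {set X i} -> bool).

(* These functionals are the linear combinations of the phi_C, so that the
   sum over a suit is a combination of indices. *)
Lemma affine_sum_eq S S' u (k : 'I_d -> int) :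
  (forall i (A : {set X i}), u i A + u i (~: A) = k i) ->
  proper_suit S -> proper_suit S' -> suit_union S = suit_union S' ->
  \sum_(A in S) \prod_i u i (A i) = \sum_(A in S') \prod_i u i (A i).
Proof.
move=> uk pS pS' eU.
have main S0 : proper_suit S0 ->
    \prod_(i < d) 4 * \sum_(A in S0) \prod_i u i (A i) =
    \sum_(C : factors X) (\prod_i phi_coef (u i) (k i) (C i)) *
      suit_index S0 C.
  move=> pS0; under [RHS]eq_bigr do rewrite mulr_sumr.
  rewrite mulr_sumr exchange_big; apply: eq_bigr => A AS.
  rewrite -big_split /=; under eq_bigr => i _ do
    rewrite -(sum_phi_coef (uk i)) ?(proper_suitP pS0 AS) //.
  by rewrite -sum_prod_dffun; apply: eq_bigr => C _; rewrite -big_split.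
have n0 : \prod_(i < d) (4 : int) != 0 by apply/prodf_neq0.
apply: (mulfI n0); rewrite !main //; apply: eq_bigr => C _.
have [bC|/forallPn[i /negPn/eqP Ci]] := boolP (is_box C).
  by rewrite (suit_index_eq bC pS pS').
by rewrite (bigD1 i) //= /phi_coef Ci eqxx !mul0r.
Qed.

Lemma box_flipE A eps i :
  box_flip A eps i = if eps i == 0 then A i else ~: A i.
Proof. by rewrite ffunE. Qed.

Lemma box_flip_inj eps : injective (fun A => box_flip A eps).
Proof.
move=> A B /ffunP e; apply/ffunP => i; have := e i.
by rewrite !box_flipE; case: ifP => // _ /setC_inj.
Qed.

(** Complementing both factors at a coordinate preserves the relation of being complementary
    there. *)
Lemma proper_suit_flip S eps : proper_suit S ->
  proper_suit [set box_flip A eps | A in S].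
Proof.
move=> pS; have pA := proper_suitP pS.
have [/andP[_ /forall_inP dS] _] := andP pS.
have fA A i : A \in S ->
    (box_flip A eps i != set0) && (box_flip A eps i != setT).
  move=> AS; have [A0 AT] := pA A AS i; rewrite box_flipE; case: ifP => _.
    by rewrite A0 AT.
  by rewrite setC_eqT A0 andbT -setCT (inj_eq (@setC_inj _)).
apply/andP; split; [apply/andP; split|].
- apply/forall_inP => _ /imsetP[A AS ->]; apply/forallP => i.
  by have /andP[] := fA A i AS.
- apply/forall_inP => _ /imsetP[A AS ->].
  apply/forall_inP => _ /imsetP[B BS ->].
  rewrite (inj_eq (@box_flip_inj eps)); apply/implyP => AB.
  have /existsP[i /eqP e] := implyP (forall_inP (dS A AS) B BS) AB.
  by apply/existsP; exists i; rewrite !box_flipE e; case: ifP.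
apply/forall_inP => _ /imsetP[A AS ->].
by apply/andP; split; apply/forallP => i; have /andP[] := fA A i AS.
Qed.

(** The flipped suit has the same union, so [affine_sum_eq] applies; its sum is then reindexed by
    [S]. *)
Lemma affine_sum_flip S eps u (k : 'I_d -> int) :
  (forall i (A : {set X i}), u i A + u i (~: A) = k i) ->
  proper_suit S -> flip_union S eps = suit_union S ->
  \sum_(A in S) \prod_i u i (A i) =
  \sum_(A in S) \prod_i u i (box_flip A eps i).
Proof.
move=> uk pS fS.
rewrite (affine_sum_eq uk pS (proper_suit_flip eps pS)).
  by rewrite big_imset //= => A B _ _ /box_flip_inj.
rewrite -fS /flip_union /suit_union.
apply/setP => x; apply/bigcupP/bigcupP => [[A AS xA]|[_ /imsetP[A AS ->] xA]].
  by exists (box_flip A eps) => //; apply: imset_f.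
by exists A.
Qed.

(* A literal inserted at a coordinate i of the support which u ignores sees
   exactly one member of each pair A, A^eps. *)
Lemma sum_even S eps u (k : 'I_d -> int) (s : 'I_d -> bool) i :
  (forall j (A : {set X j}), u j A + u j (~: A) = k j) ->
  (forall j (A : {set X j}), eps j != 0 -> u j (~: A) = (-1) ^+ s j * u j A) ->
  eps i != 0 -> (forall A : {set X i}, u i A = 1) -> (0 < #|X i|)%N ->
  proper_suit S -> flip_union S eps = suit_union S ->
  (\sum_(A in S) \prod_j u j (A j))%:~R = 0 :> 'F_2.
Proof.
move=> uk us epsi ui /card_gt0P[x _] pS fS.
pose w j : {set X j} -> int :=
  dfwith u (fun A : {set X i} => (mem_literal x A)%:R) j.
have wi (A : {set X i}) : w i A = (x \in A)%:R by rewrite /w dfwith_in.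
have wj j (A : {set X j}) : i != j -> w j A = u j A by move=> ij; rewrite /w dfwith_out.
have wk j (A : {set X j}) : w j A + w j (~: A) = if j == i then 1 else k j.
  have [e|ne] := eqVneq j i; last by rewrite !wj 1?eq_sym.
  by case: _ / (esym e) A => A; rewrite !wi inE; case: (x \in A).
have := affine_sum_flip wk pS fS.
(* The flip multiplies the factors away from [i] by the sign [sg] and negates the literal at [i];
   this gives [QE]. *)
pose sg : int := \prod_(j | (j != i) && (eps j != 0)) (-1) ^+ s j.
set P := LHS; set Q := RHS => PQ.
have QE : Q = sg * (\sum_(A in S) \prod_j u j (A j) - P).
  rewrite -sumrB mulr_sumr; apply: eq_bigr => A _.
  rewrite (bigD1 i) //= [in RHS](bigD1 i) //= [X in _ - X](bigD1 i) //=.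
  rewrite ui !wi box_flipE (negPf epsi) inE.
  rewrite [X in _ - _ * X](eq_bigr (fun j => u j (A j))); last first.
    by move=> j ji; rewrite wj // eq_sym.
  rewrite (_ : \prod_(j | j != i) w j _ = sg * \prod_(j | j != i) u j (A j)).
    by case: (x \in A i) => /=; ring.
  rewrite /sg big_mkcondr -big_split; apply: eq_bigr => j ji.
  rewrite wj ?(eq_sym i) // box_flipE; case: ifPn => [_|e] /=.
    by rewrite mul1r.
  by rewrite us.
(* Since [sg] is a sign, the right-hand side is [2 * P] or 0. *)
have -> : \sum_(A in S) \prod_j u j (A j) = P + sg * P.
  have sg2 : sg * sg = 1.
    by rewrite /sg -big_split big1 // => j _; case: (s j).
  have : sg * P = \sum_(A in S) \prod_j u j (A j) - P.
    by rewrite {1}PQ QE mulrA sg2 mul1r.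
  by move=> ->; ring.
have [b ->] : exists b : bool, sg = (-1) ^+ b.
  rewrite /sg; apply: (big_ind (fun x : int => exists b : bool, x = (-1) ^+ b)).
  - by exists false.
  - by move=> _ _ [b ->] [c ->]; exists (b (+) c); rewrite signr_addb.
  - by move=> j _; exists (s j).
case: b; rewrite ?mul1r ?mulN1r ?subrr // intrD; exact: addrr_F2.
Qed.

(** * Counting pairwise dichotomous families *)

Definition dich_on (L : {set 'I_d}) S := forall A B, A \in S -> B \in S ->
  A != B -> exists2 i, i \in L & A i = ~: B i.

(** Induction on [L]: the literal at [i] splits [S] into two halves, and members of the same half
    are not complementary at [i]. The boolean term shows that a family of full size [2 ^ #|L|] has a
    member through every point [v]. *)
Lemma dich_on_card (L : {set 'I_d}) S v : (forall i, literal (v i)) ->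
  dich_on L S ->
  (#|S| + ~~ [exists A in S, [forall i in L, v i (A i)]] <= 2 ^ #|L|)%N.
Proof.
move=> lv; have [n] := ubnP #|L|; elim: n L S => // n IH L S /ltnSE nL dS.
have [L0|[i iL]] := set_0Vmem L.
  have S1 A B : A \in S -> B \in S -> A = B.
    move=> AS BS; apply/eqP/negPn/negP => /(dS A B AS BS)[j].
    by rewrite L0 inE.
  rewrite L0 cards0; have [->|[A AS]] := set_0Vmem S.
    by rewrite cards0; case: (~~ _).
  have -> : S = [set A].
    by apply/setP => B; rewrite inE; apply/idP/eqP => [BS|->] //; exact: S1.
  rewrite cards1 (_ : [exists _ in _, _]) //; apply/exists_inP; exists A.
    by rewrite inE.
  by apply/forall_inP => j; rewrite inE.
pose Sb b := [set A in S | v i (A i) == b].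
have dSb b : dich_on (L :\ i) (Sb b).
  move=> A B; rewrite !inE => /andP[AS /eqP vA] /andP[BS /eqP vB].
  move=> /(dS A B AS BS)[j jL e]; exists j => //; rewrite !inE jL andbT.
  apply/eqP => ji; subst j; move: vA; rewrite e lv vB.
  by case: (b).
have cL : #|L| = #|L :\ i|.+1 by rewrite (cardsD1 i) iL.
have lt : (#|L :\ i| < n)%N by rewrite -cL.
have cS : #|S| = (#|Sb true| + #|Sb false|)%N.
  rewrite -(cardsID [set A : factors X | v i (A i)] S); congr (_ + _)%N; congr #|pred_of_set _|.
    by apply/setP => A; rewrite !inE eqb_id.
  by apply/setP => A; rewrite !inE eqbF_neg andbC.
have h1 := IH _ _ lt (dSb true).
have h2 := IH _ _ lt (dSb false).
rewrite cL expnS mul2n -addnn cS addnAC; apply: leq_add; last first.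
  exact: leq_trans (leq_addr _ _) h2.
(* The boolean term is charged to the half where [v i] holds: a member of it through [v] on [L :\ i]
   is through [v] on [L]. *)
apply: leq_trans h1; rewrite leq_add2l.
have [/exists_inP[A]|_] :=
  boolP [exists A in Sb true, [forall j in L :\ i, v j (A j)]]; last first.
  exact: leq_b1.
rewrite inE => /andP[AS /eqP vA] /forall_inP h; rewrite leqn0 eqb0 negbK.
apply/exists_inP; exists A => //; apply/forall_inP => j jL.
by have [->|ji] := eqVneq j i; rewrite ?vA // h // !inE ji.
Qed.

(** * Cells over a partial point *)

Section Cells.

Variables (S : {set factors X}) (eps : {ffun 'I_d -> 'Z_2}).
Hypotheses (X0 : forall i, (0 < #|X i|)%N) (pS : proper_suit S).
Hypothesis fS : flip_union S eps = suit_union S.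
Variable z : forall i, {set X i} -> bool.
Arguments z : clear implicits.
Hypothesis lz : forall i, literal (z i).
Implicit Types (t : forall i, {set X i}) (L : {set 'I_d}).

Definition flipped : {set 'I_d} := [set i | eps i != 0].

(* The members of S containing the partial point z over the coordinates outside
   the support of eps, and of the type of t over the support minus L. *)
Definition cell t L : {set factors X} :=
  [set A in S | [forall j, if eps j == 0 then z j (A j)
                 else (j \in L) || same_class (t j) (A j)]].

(** Modulo 2 this cardinality is a sum of products of literals and class signs whose factor at [i]
    is 1, so [sum_even] applies. *)
Lemma cell_even t i : eps i != 0 -> #|cell t [set i]|%:R = 0 :> 'F_2.
Proof.
move=> epsi.
pose u j (A : {set X j}) : int := if eps j == 0 then (z j A)%:R
  else if j == i then 1 else class_sign (t j) A.
rewrite -(@sum_even S eps u (fun j => if eps j == 0 then 1 else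
  if j == i then 2 else 0) (fun j => j != i) i) //.
- rewrite rmorph_sum -sum1_card natr_sum /cell big_mkcond [RHS]big_mkcond.
  apply: eq_bigr => A _; rewrite inE; case: (A \in S) => //=.
  rewrite rmorph_prod (eq_bigr (fun j => (if eps j == 0 then z j (A j)
    else (j \in [set i]) || same_class (t j) (A j))%:R)).
    by rewrite prod_natb; case: ifP.
  move=> j _; rewrite /u inE; case: ifP => _; first by case: (z j _).
  by case: (j == i); rewrite //= class_sign_F2.
- move=> j A; rewrite /u lz; case: ifP => _; first by case: (z j A).
  by case: (j == i) => //; rewrite class_signC subrr.
- move=> j A e; rewrite /u (negPf e); case: (j == i) => //=.
  by rewrite class_signC mulN1r.
- by move=> A; rewrite /u (negPf epsi) eqxx.
Qed.

(** The cell with coordinate [i] free is even and is partitioned by the class at [i], so one odd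
    class forces another. *)
Lemma cell_other_class t i : eps i != 0 -> #|cell t set0|%:R != 0 :> 'F_2 ->
  exists C : {set X i}, ~~ same_class (t i) C /\
    #|cell (dfwith t C) set0|%:R != 0 :> 'F_2.
Proof.
move=> epsi; have [x _] := card_gt0P (X0 i).
(* [rep] selects the member of each class that contains [x], so that every class is counted once. *)
pose rep (A : {set X i}) := if x \in A then A else ~: A.
have repE (A C : {set X i}) : x \in C -> (rep A == C) = same_class C A.
  move=> xC; rewrite /rep /same_class; case: ifPn => xA.
    have -> : (A == ~: C) = false; last by rewrite orbF.
    by apply/eqP => e; move: xA; rewrite e inE xC.
  have -> : (A == C) = false by apply/eqP => e; rewrite e xC in xA.
  by rewrite setC_eq.
have xr (A : {set X i}) : x \in rep A by rewrite /rep; case: ifPn => //; rewrite inE.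
have same (A : {set X i}) : same_class (rep A) =1 same_class A.
  move=> C; rewrite /rep /same_class; case: ifP => // _.
  by rewrite setCK orbC.
have cellE (C : {set X i}) : x \in C -> cell (dfwith t C) set0 =
    [set A in cell t [set i] | rep (A i) == C].
  move=> xC; apply/setP => A; rewrite !inE -andbA; congr (_ && _).
  apply/forallP/andP => [h|[/forallP h rA] j].
    split; last by have := h i; rewrite (negPf epsi) inE dfwith_in repE.
    apply/forallP => j; have := h j; case: ifP => // _; rewrite !inE /=.
    by have [//|ji] := eqVneq j i; rewrite dfwith_out // eq_sym.
  have := h j; case: ifP => // _; rewrite !inE.
  have [->|ji] := eqVneq j i; first by rewrite dfwith_in -(repE _ C).
  by rewrite dfwith_out // eq_sym.
have tE : cell t set0 = cell (dfwith t (rep (t i))) set0.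
  apply/setP => A; rewrite !inE; congr (_ && _); apply: eq_forallb => j.
  case: ifP => // _; have [->|ji] := eqVneq j i; last first.
    by rewrite dfwith_out // eq_sym.
  by rewrite dfwith_in same.
rewrite tE => odd_t.
have [C /and3P[xC Ct oC]|all0] := pickP (fun C : {set X i} =>
    [&& x \in C, C != rep (t i) & #|cell (dfwith t C) set0|%:R != 0 :> 'F_2]).
  exists C; split=> //; rewrite -same; apply: contraNN Ct.
  by rewrite -repE // => /eqP <-; rewrite /rep xC.
case/eqP: odd_t; rewrite -(cell_even t epsi).
rewrite -!sum1_card !natr_sum [RHS](partition_big (fun A => rep (A i))
  (fun C => x \in C)) //= [RHS](bigD1 (rep (t i))) //= [X in _ + X]big1.
  by rewrite addr0 cellE //; apply: eq_bigl => A; rewrite inE.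
move=> C /andP[xC CR]; have := all0 C; rewrite xC CR /= => /negbFE/eqP e.
by rewrite -[RHS]e -sum1_card natr_sum cellE //; apply: eq_bigl => A; rewrite inE.
Qed.

(** Induction on [L]: the hypothesis is applied to [t] and to a second odd type differing from it at
    [i]. The two cells obtained are disjoint and lie in [cell t L], which doubles the bound. *)
Lemma cell_card_ge t L : L \subset flipped ->
  #|cell t set0|%:R != 0 :> 'F_2 -> (2 ^ #|L| <= #|cell t L|)%N.
Proof.
have [n] := ubnP #|L|; elim: n L t => // n IH L t /ltnSE nL sL odd_t.
have [L0|[i iL]] := set_0Vmem L.
  rewrite L0 cards0 lt0n; apply: contraNneq odd_t => ->; exact: eqxx.
have epsi : eps i != 0 by have := subsetP sL i iL; rewrite inE.
have [C [tC oC]] := cell_other_class epsi odd_t.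
have cL : #|L| = #|L :\ i|.+1 by rewrite (cardsD1 i) iL.
have lt : (#|L :\ i| < n)%N by rewrite -cL.
have sL' : L :\ i \subset flipped := subset_trans (subD1set L i) sL.
have h1 := IH _ _ lt sL' odd_t.
have h2 := IH _ _ lt sL' oC.
rewrite cL expnS mul2n -addnn; apply: leq_trans (leq_add h1 h2) _.
rewrite -cardsUI (_ : _ :&: _ = set0) ?cards0 ?addn0.
  apply/subset_leq_card/subsetP => A; rewrite !inE -andb_orr => /andP[-> /=].
  case/orP => /forallP h; apply/forallP => j; have := h j;
    case: ifP => // _; rewrite !inE; have [->|ji] /= := eqVneq j i.
  - by rewrite iL.
  - by [].
  - by rewrite iL.
  - by rewrite dfwith_out // eq_sym.
(* A common member would put [C] in the class of [t i]. *)
apply/setP => A; rewrite !inE; apply/negP.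
case/andP=> /andP[_ /forallP/(_ i)] + /andP[_ /forallP/(_ i)].
rewrite (negPf epsi) !inE eqxx /= dfwith_in => tA CA; case/negP: tC.
rewrite /same_class; case/orP: tA => /eqP eA; case/orP: CA => /eqP; rewrite eA.
- by move=> <-; rewrite eqxx.
- by move=> ->; rewrite setCK eqxx orbT.
- by move=> <-; rewrite eqxx orbT.
- by move=> /setC_inj->; rewrite eqxx.
Qed.

(** The lower bound of [cell_card_ge] meets the upper bound of [dich_on_card], so some member
    contains [v]; all others are dichotomous to it and miss [v]. *)
Lemma sum_literal_cell t v : #|cell t set0|%:R != 0 :> 'F_2 ->
  (forall i, literal (v i)) -> (forall i, eps i == 0 -> v i =1 z i) ->
  \sum_(A in S) \prod_i (v i (A i))%:R = 1 :> int.
Proof.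
move=> odd_t lv vz; have [/andP[_ /forall_inP dS] _] := andP pS.
have dC : dich_on flipped (cell t flipped).
  move=> A B; rewrite !inE => /andP[AS /forallP zA] /andP[BS /forallP zB] AB.
  have /existsP[i /eqP e] := implyP (forall_inP (dS A AS) B BS) AB.
  (* Outside the support both members contain [z], so they cannot be complementary there. *)
  exists i => //; rewrite inE; apply/negP => ei.
  by have := zA i; have := zB i; rewrite ei e lz => ->.
have := dich_on_card lv dC.
have := cell_card_ge (subxx _) odd_t.
case: exists_inP => [[A AC /forall_inP vA] _ _|_ h1 h2]; last first.
  by have := leq_trans h2 h1; rewrite addn1 ltnn.
have [AS /forallP zA] : A \in S /\ [forall j, if eps j == 0 then z j (A j)
    else (j \in flipped) || same_class (t j) (A j)].
  by move: AC; rewrite inE => /andP.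
have vA' i : v i (A i).
  have [e|e] := boolP (eps i == 0); last by apply: vA; rewrite inE.
  by have := zA i; rewrite e vz.
rewrite (bigD1 A) //= big1 => [|i _]; last by rewrite vA'.
rewrite big1 ?addr0 // => B /andP[BS BA].
have /existsP[i /eqP e] := implyP (forall_inP (dS B BS) A AS) BA.
by rewrite (bigD1 i) //= e lv vA' mul0r.
Qed.

(* If the cell is odd, then S covers all points over z, and its sum is that of
   the whole box, namely 0. *)
Lemma cell_index_even B : eps != 0 -> is_box B ->
  (\sum_(A in S) \prod_i (if eps i == 0 then (z i (A i))%:R
     else class_sign (B i) (A i)))%:~R = 0 :> 'F_2.
Proof.
move=> eps0 bB.
have cE : (\sum_(A in S) \prod_i (if eps i == 0 then (z i (A i))%:R
     else class_sign (B i) (A i)))%:~R = #|cell B set0|%:R :> 'F_2.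
  rewrite rmorph_sum -sum1_card natr_sum /cell big_mkcond [RHS]big_mkcond.
  apply: eq_bigr => A _; rewrite inE; case: (A \in S) => //=.
  rewrite rmorph_prod (eq_bigr (fun j => (if eps j == 0 then z j (A j)
    else (j \in set0) || same_class (B j) (A j))%:R)).
    by rewrite prod_natb; case: ifP.
  move=> j _; rewrite inE; case: ifP => _; first by case: (z j _).
  by rewrite /= class_sign_F2.
have [e|odd_B] := eqVneq (#|cell B set0|%:R : 'F_2) 0; first by rewrite cE.
have [i epsi] : exists i, eps i != 0.
  apply/existsP; apply: contraNT eps0; rewrite negb_exists => /forallP h.
  by apply/eqP/ffunP => i; rewrite ffunE; apply/eqP; have := h i; rewrite negbK.
have [x xB] := fin_all_exists (fun i => set0Pn _ (forallP bB i)).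
pose p j (A : {set X j}) : int :=
  if eps j == 0 then (z j A)%:R else (mem_literal (x j) A)%:R.
pose q j (A : {set X j}) : int := if eps j == 0 then 0
  else - (toggle (B j) (mem_literal (x j)) A)%:R.
rewrite (eq_bigr (fun A => \sum_(J : {set 'I_d})
    \prod_j (if j \in J then p j (A j) else q j (A j)))); last first.
  move=> A _; rewrite -bigA_distr; apply: eq_bigr => j _; rewrite /p /q.
  by case: ifP => _ /=; rewrite ?addr0 // (class_signE _ (xB j)).
(* Each sum of literals over [S] equals 1, so only the coefficients remain. They recombine into a
   product whose factor at [i] is [1 - 1]. *)
rewrite exchange_big (eq_bigr (fun J : {set 'I_d} =>
    \prod_j (if j \in J then 1 else if eps j == 0 then 0 else -1))).
  by rewrite -bigA_distr (bigD1 i) //= (negPf epsi) subrr mul0r.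
move=> J _; pose v j : {set X j} -> bool := if eps j == 0 then z j
  else if j \in J then mem_literal (x j)
  else toggle (B j) (mem_literal (x j)).
have vE : \sum_(A in S) \prod_j (v j (A j))%:R = 1 :> int.
  apply: sum_literal_cell odd_B _ _ => j; last by move=> e A; rewrite /v e.
  rewrite /v; case: ifP => _; first exact: lz.
  case: ifP => _; first exact: mem_literalP.
  exact/toggleP/mem_literalP.
rewrite -[RHS]mulr1 -[X in _ = _ * X]vE mulr_sumr; apply: eq_bigr => A _.
rewrite -big_split; apply: eq_bigr => j _; rewrite /p /q /v.
by case: (j \in J); case: (eps j == 0); rewrite /= ?mul1r ?mul0r ?mulN1r.
Qed.

End Cells.

(** * Parity and sign of the index *)

Lemma phi1_setC (T : finType) (C A : {set T}) :
  phi1 C (~: A) = (-1) ^+ (C != setT) * phi1 C A.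
Proof.
rewrite /phi1; case: (C == setT); first by rewrite mul1r.
by rewrite mulN1r -/(class_sign C (~: A)) class_signC.
Qed.

(** A coordinate of the support where [B] is full is handled by [sum_even]; if there is none,
    expansion outside the support reduces to [cell_index_even]. *)
Lemma suit_index_even S eps B : (forall i, (0 < #|X i|)%N) -> proper_suit S ->
  flip_union S eps = suit_union S -> eps != 0 -> is_box B ->
  (suit_index S B)%:~R = 0 :> 'F_2.
Proof.
move=> X0 pS fS eps0 bB; rewrite /suit_index /phi.
have [/existsP[i /andP[epsi /eqP BT]]|noT] :=
    boolP [exists i, (eps i != 0) && (B i == setT)].
  apply: (@sum_even S eps (fun j => phi1 (B j)) (fun j =>
    if B j == setT then 2 else 0) (fun j => B j != setT) i) => //.
  - move=> j A; rewrite phi1_setC /phi1; case: ifP => //= _.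
    by rewrite mulN1r subrr.
  - by move=> j A _; rewrite phi1_setC.
  - by move=> A; rewrite /phi1 BT eqxx.
have BT j : eps j != 0 -> B j != setT.
  by move=> ej; move: noT; rewrite negb_exists => /forallP/(_ j); rewrite ej.
have [x xB] := fin_all_exists (fun i => set0Pn _ (forallP bB i)).
(* Outside the support, write each factor of phi_B as p + q with p and q
   signed literals. *)
pose l (J : {set 'I_d}) j : {set X j} -> bool :=
  if j \in J then mem_literal (x j) else
  if B j == setT then fun A : {set X j} => ~~ mem_literal (x j) A
  else toggle (B j) (mem_literal (x j)).
pose p j (A : {set X j}) : int := if eps j == 0
  then (l setT j A)%:R else phi1 (B j) A.
pose q j (A : {set X j}) : int := if eps j == 0
  then (if B j == setT then 1 else -1) * (l set0 j A)%:R else 0.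
rewrite (eq_bigr (fun A => \sum_(J : {set 'I_d})
    \prod_j (if j \in J then p j (A j) else q j (A j)))); last first.
  move=> A _; rewrite -bigA_distr; apply: eq_bigr => j _; rewrite /p /q /l !inE.
  case: ifP => _ /=; last by rewrite addr0.
  rewrite /phi1; case: ifP => _; first by case: (mem_literal _ _).
  by rewrite -/(class_sign _ _) (class_signE _ (xB j)) mulN1r.
rewrite exchange_big rmorph_sum big1 // => J _.
(* [c] collects the signs; its value 0 removes the terms in which [J] omits a coordinate of the
   support, where [q] vanishes. *)
pose c j : int := if j \in J then 1 else
  if eps j == 0 then (if B j == setT then 1 else -1) else 0.
rewrite (eq_bigr (fun A => (\prod_j c j) * \prod_j (if eps j == 0
    then (l J j (A j))%:R else class_sign (B j) (A j)))).
  rewrite -mulr_sumr /= intrM cell_index_even ?mulr0 // => j.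
  rewrite /l; case: ifP => _; first exact: mem_literalP.
  case: ifP => _; last exact/toggleP/mem_literalP.
  by move=> A; rewrite mem_literalP.
move=> A _; rewrite -big_split; apply: eq_bigr => j _; rewrite /p /q /c /l !inE.
case: (boolP (eps j == 0)) => [_|/BT/negPf e].
  by case: (j \in J); rewrite /= ?mul1r.
by case: (j \in J); rewrite /= ?mul1r ?mul0r // /phi1 e.
Qed.

(** By [phi1_setC], the flip contributes one sign for each coordinate of the support where [B] is
    not full. *)
Lemma suit_index_flip S eps B : proper_suit S ->
  flip_union S eps = suit_union S ->
  suit_index S B = (-1) ^+ #|proper_coords B :&: supp eps| * suit_index S B.
Proof.
move=> pS fS; rewrite {1}/suit_index /phi.
rewrite (@affine_sum_flip S eps (fun j => phi1 (B j)) (fun j =>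
    if B j == setT then 2 else 0)) // => [|j A]; last first.
  by rewrite phi1_setC /phi1; case: ifP => //= _; rewrite mulN1r subrr.
rewrite /suit_index /phi mulr_sumr; apply: eq_bigr => A _.
rewrite -prodr_const [X in _ = X * _]big_mkcond -big_split; apply: eq_bigr => j _ /=.
rewrite !inE box_flipE.
have -> : (eps j == 1) = (eps j != 0) by case: (eps j) => [[|[|]]].
case: (eps j == 0); first by rewrite andbF mul1r.
by rewrite andbT phi1_setC; case: (B j != setT).
Qed.

End Suits.

Unset Implicit Arguments.
Set Strict Implicit.

Theorem theorem7p5 (d : nat) (X : 'I_d -> finType) (hX : forall i, (0 < #|X i|)%N)
    (F : {set dbox X}) (hF : polybox F)
    (eps : {ffun 'I_d -> 'Z_2}) (heps : eps != 0)
    (hflip : polybox_flip F eps = F)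
    (B : factors X) (hB : is_box B) (hBX : setXn B != [set: dbox X]) :
  (ind F B = 0 %[mod 2])%Z /\
  (odd #|proper_coords B :&: supp eps| -> ind F B = 0).
Proof.
(* If [F] has no proper suit, which requires some [X i] to be a singleton, [ind] is by default an
   empty sum. *)
have [S hS|noS] := pickP (proper_suit_for F); last first.
  have -> : ind F B = 0; last by [].
  rewrite /ind /a_proper_suit; case: pickP => [S|_]; first by rewrite noS.
  by rewrite /suit_index big_set0.
have [pS /eqP uS] := andP hS.
have fS : flip_union S eps = suit_union S by rewrite -(polybox_flipE eps hS) uS.
rewrite (indE hB hS); split.
  by apply: intr_F2_eq0; apply: (suit_index_even (eps := eps)).
(* An odd exponent makes the index equal to its own negative. *)
move=> o; have := suit_index_flip B pS fS.
rewrite -signr_odd o mulN1r; lia.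
Qed.
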